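(* Let $R$ be a ring of stable range $1$ which has the $D$-property. If $a\in R$ is a $2$-simple element, then there exists $\Delta\in R$ such that $\mathrm{diag}(a,a)\sim\mathrm{diag}(1,\Delta)$ (as $2\times 2$ matrices over $R$).
   Context: Rings are associative (not necessarily commutative) with $1\neq 0$. $R$ has stable range $1$ if, whenever $aR+bR=R$ with $a,b\in R$, there is $t\in R$ with $(a+bt)R=R$. $R$ has the $D$-property if for each $a\in R$ there is $a_*\in R$ with $RaR=a_*R=Ra_*$. An element $a\in R$ with $RaR=R$ is $n$-simple if $n$ is the minimal positive integer for which there exist $u_1,\ldots,u_n,v_1,\ldots,v_n\in R$ with $u_1av_1+\cdots+u_nav_n=1$; in particular $a$ is $2$-simple if $u_1av_1+u_2av_2=1$ for some $u_1,u_2,v_1,v_2\in R$ and $n=2$ is minimal. $A\sim B$ (equivalence) means $A=PBQ$ for some invertible square matrices $P,Q$ over $R$ of suitable sizes. *)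

(* Defs.v *)
From mathcomp Require Import all_boot all_order all_algebra.
From mathcomp Require Import classical_sets.
Set Implicit Arguments.
Unset Strict Implicit.
Unset Printing Implicit Defensive.
Import GRing.Theory.
Local Open Scope classical_set_scope.
Local Open Scope ring_scope.

Definition right_principal (R : nzRingType) (a : R) : set R :=
  [set a * r | r in [set: R]].

Definition left_principal (R : nzRingType) (a : R) : set R :=
  [set r * a | r in [set: R]].

(* RaR consists of the finite sums of products u * a * v, not only of the
   products themselves. *)
Definition two_sided_principal (R : nzRingType) (a : R) : set R :=
  [set x | exists (n : nat) (u v : 'I_n -> R), x = \sum_(i < n) u i * a * v i].

Definition ideal_sum (R : nzRingType) (I J : set R) : set R :=
  [set x + y | x in I & y in J].

Definition stable_range1 (R : nzRingType) : Prop :=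
  forall a b : R,
    ideal_sum (right_principal a) (right_principal b) = [set: R] ->
    exists t : R, right_principal (a + b * t) = [set: R].

Definition D_property (R : nzRingType) : Prop :=
  forall a : R, exists a' : R,
    two_sided_principal a = right_principal a' /\
    right_principal a' = left_principal a'.

Definition unit_sum (R : nzRingType) (n : nat) (a : R) : Prop :=
  exists u v : 'I_n -> R, \sum_(i < n) u i * a * v i = 1.

Definition n_simple (R : nzRingType) (n : nat) (a : R) : Prop :=
  [/\ two_sided_principal a = [set: R],
      (0 < n)%N,
      unit_sum n a
    & forall m : nat, (0 < m)%N -> unit_sum m a -> (n <= m)%N].

(* [unitmx] is only available over commutative rings. *)
Definition invertible_mx (R : nzRingType) (n : nat) (P : 'M[R]_n) : Prop :=
  exists P' : 'M[R]_n, P *m P' = 1%:M /\ P' *m P = 1%:M.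

Definition equiv_mx (R : nzRingType) (m n : nat) (A B : 'M[R]_(m, n)) : Prop :=
  exists (P : 'M[R]_m) (Q : 'M[R]_n),
    [/\ invertible_mx P, invertible_mx Q & A = P *m B *m Q].

Definition diag2 (R : nzRingType) (a b : R) : 'M[R]_2 :=
  diag_mx (\row_(j < 2) [:: a; b]`_j).

(* Main.v *)
Require Import Defs.
From mathcomp Require Import all_boot all_order all_algebra.
From mathcomp Require Import classical_sets.
Import GRing.Theory.
Local Open Scope ring_scope.

(** Write [u1 * a * v1 + u2 * a * v2 = 1]. The row [(u1, u2)] is right
unimodular, so stable range 1 makes it the first row of an invertible matrix
[P] ([unimodular_row_completion]). The first row [(u1 * a, u2 * a)] of
[P *m diag2 a a] is again right unimodular; stable range 1 provides a column
operation that turns its first entry into a right invertible element, which is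
a unit because a ring of stable range 1 is Dedekind-finite
([stable_range1_dedekind_finite]). Clearing the first row and column with this
unit as pivot leaves [diag2 1 Delta] ([equiv_diag2_of_unimodular_row]).

Both uses of stable range 1 concern right unimodular rows, so its left-right
symmetry is not needed, as it would be if the column [(v1, v2)] were completed
to an invertible matrix. *)

Lemma sum_of_unimodular {R : nzRingType} {a b x y : R} :
  a * x + b * y = 1 ->
  ideal_sum (right_principal a) (right_principal b) = [set: R]%classic.
Proof.
move=> abE; rewrite -subTset => z _.
exists (a * (x * z)); first by exists (x * z).
exists (b * (y * z)); first by exists (y * z).
by rewrite !mulrA -mulrDl abE mul1r.
Qed.

Lemma stable_range1_right_inv {R : nzRingType} (sr1 : stable_range1 R)
  {a b x y : R} :
  a * x + b * y = 1 -> exists t z : R, (a + b * t) * z = 1.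
Proof.
move=> /sum_of_unimodular /sr1 [t tE].
have [z _ zE] : right_principal (a + b * t) 1 by rewrite tE.
by exists t, z.
Qed.

Lemma stable_range1_dedekind_finite {R : nzRingType} (sr1 : stable_range1 R)
  {x y : R} : x * y = 1 -> y * x = 1.
Proof.
move=> xy1.
have : y * x + (1 - y * x) * 1 = 1 by rewrite mulr1 addrC subrK.
case/(stable_range1_right_inv sr1)=> t [z yz1].
(* [x] is a left inverse of [y + (1 - y * x) * t], since [x] kills
   [1 - y * x] on the left; it thus equals the right inverse [z], so that [x] is
   invertible and its right inverse [y] is also a left inverse. *)
have xw1 : x * (y + (1 - y * x) * t) = 1.
  by rewrite mulrDr mulrA mulrBr mulr1 mulrA xy1 mul1r subrr mul0r addr0.
have xz : x = z by rewrite -[x]mulr1 -yz1 mulrA xw1 mul1r.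
set w := y + _ in yz1 xw1.
have wx1 : w * x = 1 by rewrite -[RHS]yz1 xz.
have -> // : y = w by rewrite -[LHS]mul1r -wx1 -mulrA xy1 mulr1.
Qed.

(** A row [(a, b)] with [aR + bR = R] can be turned into one starting with a
unit by adding a right multiple of [b] to [a]. *)
Lemma stable_range1_unit {R : nzRingType} (sr1 : stable_range1 R)
  {a b x y : R} :
  a * x + b * y = 1 ->
  exists t z : R, (a + b * t) * z = 1 /\ z * (a + b * t) = 1.
Proof.
move=> /(stable_range1_right_inv sr1) [t [z tz1]]; exists t, z; split=> //.
exact: (stable_range1_dedekind_finite sr1).
Qed.

Lemma invertible_mxM {R : nzRingType} {n : nat} {P Q : 'M[R]_n} :
  invertible_mx P -> invertible_mx Q -> invertible_mx (P *m Q).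
Proof.
move=> [P' [PP' P'P]] [Q' [QQ' Q'Q]]; exists (Q' *m P'); split.
  by rewrite mulmxA -(mulmxA P) QQ' mulmx1.
by rewrite mulmxA -(mulmxA Q') P'P mulmx1.
Qed.

Lemma equiv_mx_trans {R : nzRingType} {m n : nat} {A B C : 'M[R]_(m, n)} :
  equiv_mx A B -> equiv_mx B C -> equiv_mx A C.
Proof.
move=> [P [Q [iP iQ ->]]] [P2 [Q2 [iP2 iQ2 ->]]].
exists (P *m P2), (Q2 *m Q); split; try exact: invertible_mxM.
by rewrite !mulmxA.
Qed.

Lemma equiv_mx_mul {R : nzRingType} {m n : nat} (A : 'M[R]_(m, n))
  {P : 'M[R]_m} {Q : 'M[R]_n} :
  invertible_mx P -> invertible_mx Q -> equiv_mx A (P *m A *m Q).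
Proof.
move=> [P' [PP' P'P]] [Q' [QQ' Q'Q]]; exists P', Q'; split.
- by exists P.
- by exists Q.
by rewrite !mulmxA P'P mul1mx -mulmxA QQ' mulmx1.
Qed.

(** The 2 x 2 matrix with rows [(a, b)] and [(c, d)], assembled from 1 x 1
blocks so that the block product formula applies. *)
Definition mx2 {R : nzRingType} (a b c d : R) : 'M[R]_2 :=
  @block_mx R 1 1 1 1 a%:M b%:M c%:M d%:M.

Lemma mulmx2 {R : nzRingType} (a b c d a' b' c' d' : R) :
  mx2 a b c d *m mx2 a' b' c' d' =
  mx2 (a * a' + b * c') (a * b' + b * d') (c * a' + d * c') (c * b' + d * d').
Proof.
rewrite /mx2 (@mulmx_block R 1 1 1 1 1 1).
by rewrite -!scalar_mxM -!raddfD.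
Qed.

Lemma mx2_1 {R : nzRingType} : mx2 1 0 0 1 = 1%:M :> 'M[R]_2.
Proof. by rewrite /mx2 !raddf0 -scalar_mx_block. Qed.

Lemma diag2E {R : nzRingType} (a d : R) : diag2 a d = mx2 a 0 0 d.
Proof.
apply/matrixP=> i j; rewrite /mx2 !mxE.
by case: splitP => i' iE; rewrite !mxE; case: splitP => j' jE;
  rewrite !mxE !ord1 -!val_eqE /= iE jE !ord1.
Qed.

Lemma invertible_mx2_lower {R : nzRingType} (c : R) :
  invertible_mx (mx2 1 0 c 1).
Proof.
exists (mx2 1 0 (- c) 1); rewrite !mulmx2 !(mulr0, mul0r, mulr1, mul1r).
by rewrite !addr0 !add0r subrr addNr mx2_1.
Qed.

Lemma invertible_mx2_upper {R : nzRingType} {e f z : R} :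
  e * z = 1 -> z * e = 1 -> invertible_mx (mx2 e f 0 1).
Proof.
move=> ez ze; exists (mx2 z (- (z * f)) 0 1).
rewrite !mulmx2 !(mulr0, mul0r, mulr1, mul1r) !addr0 !add0r.
by rewrite mulrN mulrA ez ze mul1r addNr subrr mx2_1.
Qed.

Lemma unimodular_row_completion {R : nzRingType} (sr1 : stable_range1 R)
  {a b x y : R} :
  a * x + b * y = 1 -> exists c d : R, invertible_mx (mx2 a b c d).
Proof.
move=> /(stable_range1_unit sr1) [t [z [wz zw]]]; exists (- t), 1.
have -> : mx2 a b (- t) 1 = mx2 (a + b * t) b 0 1 *m mx2 1 0 (- t) 1.
  by rewrite mulmx2 !(mulr0, mul0r, mulr1, mul1r) !add0r mulrN addrK.
apply: invertible_mxM; last exact: invertible_mx2_lower.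
exact: invertible_mx2_upper wz zw.
Qed.

Lemma equiv_diag2_of_unit_pivot {R : nzRingType} {e z : R} (f g h : R) :
  e * z = 1 -> z * e = 1 ->
  equiv_mx (mx2 e f g h) (diag2 1 (h - g * z * f)).
Proof.
move=> ez ze; exists (mx2 1 0 (g * z) 1), (mx2 e f 0 1); split.
- exact: invertible_mx2_lower.
- exact: invertible_mx2_upper ez ze.
rewrite diag2E !mulmx2 !(mulr0, mul0r, mulr1, mul1r) !addr0 !add0r.
by rewrite -(mulrA g z e) ze mulr1 addrCA subrr addr0 !mul1r.
Qed.

Lemma equiv_diag2_of_unimodular_row {R : nzRingType} (sr1 : stable_range1 R)
  {a b x y : R} (c d : R) :
  a * x + b * y = 1 ->
  exists Delta : R, equiv_mx (mx2 a b c d) (diag2 1 Delta).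
Proof.
move=> /(stable_range1_unit sr1) [s [z [ez ze]]].
exists (d - (c + d * s) * z * b).
apply: (equiv_mx_trans _ (equiv_diag2_of_unit_pivot _ _ _ ez ze)).
have <- : 1%:M *m mx2 a b c d *m mx2 1 0 s 1 =
    mx2 (a + b * s) b (c + d * s) d.
  by rewrite mul1mx mulmx2 !(mulr0, mulr1) !add0r.
apply: equiv_mx_mul; last exact: invertible_mx2_lower.
by exists 1%:M; rewrite mulmx1.
Qed.

Theorem theorem2p7 (R : nzRingType) (sr1 : stable_range1 R)
  (dp : D_property R) (a : R) (ha : n_simple 2 a) :
  exists Delta : R, equiv_mx (diag2 a a) (diag2 1 Delta).
Proof.
case: ha => _ _ [u [v uav1]] _; move: uav1.
rewrite !big_ord_recl big_ord0 addr0.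
set i := lift _ _ => uav1.
have : u ord0 * (a * v ord0) + u i * (a * v i) = 1 by rewrite !mulrA.
case/(unimodular_row_completion sr1) => c [d iP].
have [Delta eqD] := equiv_diag2_of_unimodular_row sr1 (c * a) (d * a) uav1.
exists Delta; apply: (equiv_mx_trans _ eqD).
have <- : mx2 (u ord0) (u i) c d *m diag2 a a *m 1%:M =
    mx2 (u ord0 * a) (u i * a) (c * a) (d * a).
  by rewrite mulmx1 diag2E mulmx2 !mulr0 !addr0 !add0r.
apply: (equiv_mx_mul _ iP).
by exists 1%:M; rewrite mulmx1.
Qed.
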